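(* Let $G$ be any group with a finite collection $\{\sigma_j\mid j=1,\ldots,n\}$ of pairwise non-isomorphic splittings. Suppose $\{\sigma_j\mid j=1,\ldots,n\}$ satisfies sandwiching. For each $j$, let $X_j$ be a standard $H_j$-almost invariant set arising from $\sigma_j$. Then there exist $H_j$-almost invariant sets $X'_j$ that are $H_j$-almost equal to $X_j$ ($j=1,\ldots,n$) such that $\Sigma':=\bigcup_{j=1}^n\Sigma(X'_j)$ is in very good position.
   Context: For $X\subset G$, $X^*=G\setminus X$, $\Sigma(X)=\{gX,gX^*\mid g\in G\}$, $\mathrm{Stab}(X)=\{g: gX=X\}$. A subset of $G$ is $H$-finite if it is contained in finitely many right cosets $Hg_i$. Two subsets of $G$ are $H$-almost equal if their symmetric difference is $H$-finite. $X\subset G$ is $H$-almost invariant if $hX=X$ for all $h\in H$, and $Xg$ is $H$-almost equal to $X$ for all $g\in G$. The corners of a pair $(A,B)$ are $A\cap B$, $A\cap B^*$, $A^*\cap B$, $A^*\cap B^*$. A $G$-tree is a simplicial tree with a simplicial $G$-action that inverts no edge. A splitting of $G$ is a $G$-tree $T$ with no global fixed point such that $G\backslash T$ has exactly one edge. Two splittings are isomorphic if their trees are $G$-equivariantly isomorphic. A standard $H$-almost invariant set arising from the splitting is a set $X=\{g\in G : e \text{ points away from } gv\}$, where $v$ is a vertex of $T$, $e$ is a directed edge of $T$, and $H=\mathrm{Stab}(e)=\mathrm{Stab}(X)$; ''$e$ points away from $gv$'' means that $gv$ lies in the component of $T$ minus the interior of $e$ containing the initial vertex of $e$. For $A,B$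 in $\bigcup_j\Sigma(X_j)$ (or in $\Sigma'$), a corner of $(A,B)$ is small if it is $\mathrm{Stab}(A)$-finite (equivalently, here, $\mathrm{Stab}(B)$-finite); $A$ crosses $B$ if no corner is small. $A\leq B$ means that $A\cap B^*$ is empty or is the only small corner of $(A,B)$. A collection is in good position if whenever two corners of a pair $(A,B)$ of its elements are small, one of these small corners is empty. It is in very good position if it is in good position and for all its elements $A,B$: $A\subset B$ if and only if $A\leq B$. Sandwiching: $X_j$ is sandwiched by $X_k$ if either there exist $A,B\in\Sigma(X_k)$ with $A\leq X_j\leq B$, or $X_j$ crosses every element of $\Sigma(X_k)$. $\{\sigma_j\}$ satisfies sandwiching if for all $j,k$, $X_j$ is sandwiched by $X_k$ (independent of the choice of the $X_j$). *)

(* Defs.v *)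
(* MathComp with its classical sets: a group is a [groupType] (not necessarily
   finite), a subset of it is a [set G]. *)
From mathcomp Require Import all_boot all_classical.

Set Implicit Arguments.
Unset Strict Implicit.
Unset Printing Implicit Defensive.

Local Open Scope classical_set_scope.
Local Open Scope group_scope.

Section AlmostInvariantSets.
Variable G : groupType.
Implicit Types (g : G) (H X Y A B : set G) (F : set (set G)).

Definition ltrans g X : set G := [set g * x | x in X].
Definition rtrans X g : set G := [set x * g | x in X].

Definition Sigma X : set (set G) :=
  [set A | exists g, A = ltrans g X \/ A = ltrans g (~` X)].

Definition Stab X : set G := [set g | ltrans g X = X].

Definition Hfinite H X :=
  exists2 S : set G, finite_set S & X `<=` \bigcup_(g in S) rtrans H g.

Definition almost_equal H X Y := Hfinite H ((X `\` Y) `|` (Y `\` X)).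

Definition almost_invariant H X :=
  (forall h, H h -> ltrans h X = X) /\
  (forall g, almost_equal H (rtrans X g) X).

(* The four corners of (A, B) are indexed by pairs of booleans, [false] standing
   for the complement: A `&` ~` B is the corner (true, false).  Hence "two
   corners" below means two different indices. *)
Definition side (b : bool) A := if b then A else ~` A.
Definition corner A B (c : bool * bool) : set G := side c.1 A `&` side c.2 B.

Definition small A B (c : bool * bool) := Hfinite (Stab A) (corner A B c).

Definition crosses A B := forall c, ~ small A B c.

Definition ai_le A B :=
  corner A B (true, false) = set0 \/
  (forall c, small A B c <-> c = (true, false)).

Definition good_position F :=
  forall A B, F A -> F B ->
  forall c d, c <> d -> small A B c -> small A B d ->
  corner A B c = set0 \/ corner A B d = set0.

Definition very_good_position F :=
  good_position F /\
  forall A B, F A -> F B -> (A `<=` B <-> ai_le A B).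

(* X is sandwiched by Y *)
Definition sandwiched X Y :=
  (exists A B, [/\ Sigma Y A, Sigma Y B, ai_le A X & ai_le X B]) \/
  (forall A, Sigma Y A -> crosses X A).

End AlmostInvariantSets.

(* A simplicial tree is given by its vertices and the adjacency relation, so
   that a directed edge is an ordered pair of adjacent vertices. *)
Record gtree (G : groupType) := GTree {
  vtx :> choiceType;
  adj : rel vtx;
  adj_irr : irreflexive adj;
  adj_sym : symmetric adj;
  adj_connected : forall u v, exists2 p, path adj u p & last u p = v;
  adj_acyclic : forall c, 2 < size c -> ~ ucycle adj c;
  act : G -> vtx -> vtx;
  act1 : forall v, act 1 v = v;
  actM : forall g h v, act (g * h) v = act g (act h v);
  act_adj : forall g u v, adj u v -> adj (act g u) (act g v);
  act_noinv : forall g u v, adj u v -> ~ (act g u = v /\ act g v = u)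
}.

Section Splittings.
Variable G : groupType.
Implicit Types (T : gtree G) (H X : set G).

(* As no edge is inverted, an element fixing an interior point of an edge fixes
   its endpoints, so a global fixed point can be taken to be a vertex. *)
Definition no_global_fixpoint T := ~ exists v : T, forall g, act g v = v.

Definition one_edge_orbit T :=
  (exists u v : T, adj u v) /\
  forall u v u' v' : T, adj u v -> adj u' v' ->
  exists g, (act g u = u' /\ act g v = v') \/ (act g u = v' /\ act g v = u').

Definition splitting T := no_global_fixpoint T /\ one_edge_orbit T.

Definition gtree_iso T1 T2 :=
  exists f : T1 -> T2,
  [/\ bijective f, forall u v, adj (f u) (f v) = adj u v
    & forall g u, f (act g u) = act g (f u)].

Definition edge_removed T (a b : T) : rel T :=
  [rel x y | [&& adj x y, (x, y) != (a, b) & (x, y) != (b, a)]].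

(* The edge directed from a to b points away from w. *)
Definition points_away T (a b w : T) :=
  exists2 p, path (edge_removed a b) a p & last a p = w.

Definition edge_stab T (a b : T) : set G :=
  [set g | act g a = a /\ act g b = b].

Definition standard T H X :=
  exists v a b : T,
  [/\ adj a b, X = [set g | points_away a b (act g v)],
      H = edge_stab a b & H = Stab X].

(* Sandwiching does not depend on the standard sets chosen; asking for it for
   some choice makes it the weakest hypothesis. *)
Definition sandwiching n (T : 'I_n -> gtree G) :=
  exists X : 'I_n -> set G,
  (forall j, exists H, standard (T j) H (X j)) /\
  (forall j k, sandwiched (X j) (X k)).

End Splittings.

(* Main.v *)
Require Import Defs.
From mathcomp Require Import all_boot all_classical.

(** For almost invariant sets that are nontrivial (neither they nor their
complements are finite over the stabiliser), [A <~ B], meaning that [A] minus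
[B] is finite over the stabiliser of [A], is a preorder reversed by complements.
The translates of [X_j] and their complements are the pullbacks
[{g | g v_j \in Z}] of the half-trees [Z] of [T_j].  It suffices to choose new
base vertices [w_j] compatibly: if [{g | g v_j \in Z} <~ {g | g v_k \in W}]
and [w_j \in Z], then [w_k \in W].  Pulling back along the [w_j] then turns the
preorder into inclusion, and changing base vertices is an almost equality.

The [w_j] are chosen one after the other.  The half-trees of [T_k] forced to
contain [w_k] pairwise intersect, so they have a common vertex unless they cut
out an end of [T_k]; sandwiching excludes this.

If a half-tree of [T_k] is almost equal to one of [T_j], both have the same
stabiliser, and [X'_k] is taken to be a pullback of a half-tree of [T_j], which
adds nothing to the collection.  The vertices [w_j] are therefore needed only
for one [j] in each class. *)

Set Implicit Arguments.
Unset Strict Implicit.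
Unset Printing Implicit Defensive.

Local Open Scope classical_set_scope.
Local Open Scope group_scope.

(** * Almost invariant sets *)

Section AlmostInvariance.
Variable G : groupType.
Implicit Types (g h x y : G) (K X Y A B C : set G).

Lemma ltransE g X : ltrans g X = [set x | X (g^-1 * x)].
Proof.
apply/seteqP; split=> x /=; first by case=> y Xy <-; rewrite mulKg.
by move=> Xx; exists (g^-1 * x); rewrite ?mulVKg.
Qed.

Lemma rtransE X g : rtrans X g = [set x | X (x * g^-1)].
Proof.
apply/seteqP; split=> x /=; first by case=> y Xy <-; rewrite mulgK.
by move=> Xx; exists (x * g^-1); rewrite ?mulgVK.
Qed.

Lemma ltransM g h X : ltrans (g * h) X = ltrans g (ltrans h X).
Proof. by rewrite !ltransE; apply/seteqP; split=> x /=; rewrite invgM mulgA. Qed.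

Lemma ltrans1 X : ltrans 1 X = X.
Proof. by rewrite ltransE; apply/seteqP; split=> x /=; rewrite invg1 mul1g. Qed.

Lemma ltransC g X : ltrans g (~` X) = ~` ltrans g X.
Proof. by rewrite !ltransE. Qed.

Lemma StabP X g : Stab X g <-> forall x, X (g * x) <-> X x.
Proof.
rewrite /Stab /= ltransE; split=> [E x|E].
  by rewrite -[in X (g * x)]E /= mulKg.
by apply/seteqP; split=> x /=; rewrite -(E (g^-1 * x)) mulVKg.
Qed.

Lemma Stab1 X : Stab X 1. Proof. exact: ltrans1. Qed.

Lemma StabM X g h : Stab X g -> Stab X h -> Stab X (g * h).
Proof. by rewrite /Stab /= ltransM => gX ->. Qed.

Lemma StabV X g : Stab X g -> Stab X g^-1.
Proof. by rewrite /Stab /= => {1}<-; rewrite -ltransM mulVg ltrans1. Qed.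

Lemma StabC X : Stab (~` X) = Stab X.
Proof.
apply/seteqP; split=> g; rewrite /Stab /= ltransC => E; last by rewrite E.
by apply: setC_inj.
Qed.

Lemma Stab_ltrans g h X : Stab X h -> Stab (ltrans g X) (g * h * g^-1).
Proof. by rewrite /Stab /= => E; rewrite !ltransM -(ltransM g^-1) mulVg ltrans1 E. Qed.

(** * Finiteness over a stabiliser *)

Lemma HfiniteS K X Y : X `<=` Y -> Hfinite K Y -> Hfinite K X.
Proof. by move=> XY [S finS YS]; exists S => //; apply: subset_trans YS. Qed.

Lemma HfiniteU K X Y : Hfinite K X -> Hfinite K Y -> Hfinite K (X `|` Y).
Proof.
move=> [S finS XS] [S' finS' YS']; exists (S `|` S'); first by rewrite finite_setU.
by rewrite bigcup_setU; apply: setUSS.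
Qed.

Lemma Hfinite0 K : Hfinite K set0.
Proof. by exists set0 => //; apply: finite_set0. Qed.

Lemma HfiniteP K X : Hfinite K X <->
  exists2 S : set G, finite_set S & forall x, X x -> exists2 s, S s & K (x * s^-1).
Proof.
split=> -[S finS XS]; exists S => // x /XS.
  by case=> s Ss; rewrite rtransE; exists s.
by case=> s Ss Ks; exists s; rewrite ?rtransE.
Qed.

Lemma Hfinite_ltrans g A X :
  Hfinite (Stab A) X -> Hfinite (Stab (ltrans g A)) (ltrans g X).
Proof.
move=> /HfiniteP[S finS XS]; apply/HfiniteP.
exists [set g * s | s in S]; first exact: finite_image.
move=> x; rewrite ltransE /= => /XS[s Ss /(@Stab_ltrans g) Hs].
exists (g * s); first by exists s.
by rewrite invgM; move: Hs; rewrite -!mulgA mulVKg.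
Qed.

(** By pigeonhole two of the points [h ^+ n * x] lie in the same coset of [Stab A]. *)
Lemma Hfinite_powers A X h x :
  Hfinite (Stab A) X -> (forall n, X (h ^+ n * x)) ->
  exists2 p, 0 < p & Stab A (h ^+ p).
Proof.
move=> /HfiniteP[S finS XS] hX.
have /choice[s sP] n : exists s, S s /\ Stab A (h ^+ n * x * s^-1).
  by have [s ? ?] := XS _ (hX n); exists s.
have [m [n [mn smn]]] : exists m n, m < n /\ s m = s n.
  apply: contrapT => inj; apply: infinite_nat.
  rewrite [setT](_ : _ = s @^-1` S).
    apply: finite_preimage => // m n _ _ smn.
    by case: (ltngtP m n) => // mn; case: inj; [exists m, n|exists n, m].
  by apply/seteqP; split=> n // _; case: (sP n).
exists (n - m); first by rewrite subn_gt0.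
have [[_ /StabV Hm] [_ Hn]] := (sP m, sP n).
have := StabM Hn Hm; rewrite smn !invgM invgK expgnFr ?(ltnW mn) //.
by rewrite !mulgA mulgVK mulgK.
Qed.

(** * The preorder on nontrivial almost invariant sets *)

Definition lea A B := Hfinite (Stab A) (A `&` ~` B).

Definition nontrivial_ai A :=
  [/\ almost_invariant (Stab A) A, ~ Hfinite (Stab A) A
    & ~ Hfinite (Stab A) (~` A)].

Lemma Hfinite_bigcup K (S : set G) (F : G -> set G) :
  finite_set S -> (forall s, S s -> Hfinite K (F s)) ->
  Hfinite K (\bigcup_(s in S) F s).
Proof.
move=> finS FS.
have /choice[R RP] s : exists R : set G, S s ->
    finite_set R /\ forall x, F s x -> exists2 r, R r & K (x * r^-1).
  have [Ss|nSs] := pselect (S s); last by exists set0.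
  by have /HfiniteP[R ? ?] := FS _ Ss; exists R.
apply/HfiniteP; exists (\bigcup_(s in S) R s).
  by apply: bigcup_finite => // s Ss; case: (RP s Ss).
move=> x [s Ss Fsx]; have [_ /(_ x Fsx)[r Rr Kr]] := RP s Ss.
by exists r => //; exists s.
Qed.

Lemma almost_invariantW A g :
  almost_invariant (Stab A) A -> Hfinite (Stab A) [set x | A x /\ ~ A (x * g)].
Proof.
case=> _ /(_ g^-1); apply: HfiniteS => x /= [Ax nAx].
by right; rewrite rtransE /= invgK.
Qed.

(* A [Stab B]-orbit inside [P] avoiding [A] serves as a base point: each
   [Stab B]-coset meeting [D] is moved out of [A] by one right translation. *)
Lemma Hfinite_transfer A B D P :
  almost_invariant (Stab A) A -> D `<=` A -> Hfinite (Stab B) D ->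
  Stab B `<=` Stab P -> ~ Hfinite (Stab B) P -> Hfinite (Stab B) (P `&` A) ->
  Hfinite (Stab A) D.
Proof.
move=> aiA DA /HfiniteP[S finS DS] BP infP /HfiniteP[R finR PR].
have [y Py yR] : exists2 y, P y & forall r, R r -> ~ Stab B (y * r^-1).
  apply: contrapT => noy; apply: infP; apply/HfiniteP; exists R => // y Py.
  apply: contrapT => yR; apply: noy; exists y => // r Rr Br.
  by apply: yR; exists r.
apply: (@HfiniteS _ _ (\bigcup_(s in S) [set x | A x /\ ~ A (x * (s^-1 * y))])).
  move=> x Dx; have [s Ss Bxs] := DS _ Dx; exists s => //=; split; first exact: DA.
  rewrite mulgA => Axy; have /StabP/(_ y)[_ Pxy] := BP _ Bxs.
  have [r Rr Br] := PR _ (conj (Pxy Py) Axy); apply: (yR r Rr).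
  by have := StabM (StabV Bxs) Br; rewrite -(mulgA (x * s^-1)) mulKg.
by apply: Hfinite_bigcup => // s _; apply: almost_invariantW.
Qed.

Lemma nontrivial_aiC A : nontrivial_ai A -> nontrivial_ai (~` A).
Proof.
case=> aiA infA infCA; rewrite /nontrivial_ai StabC setCK; split=> //.
split=> [h|g]; first by rewrite -StabC.
have [_ /(_ g)] := aiA; apply: HfiniteS => x /=.
by rewrite !rtransE => -[[? ?]|[? ?]]; [right|left]; split=> //; apply: contrapT.
Qed.

(** A transfer with [P := A]: as [A] is not finite over [Stab A] but its part in [B] is, some
    [Stab A]-orbit in [A] avoids [B]. *)
Lemma small_sym A B : nontrivial_ai A -> nontrivial_ai B ->
  Hfinite (Stab A) (A `&` B) -> Hfinite (Stab B) (A `&` B).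
Proof.
by move=> [_ infA _] [aiB _ _] AB; apply: (Hfinite_transfer (P := A) aiB _ AB) => // x [].
Qed.

Lemma lea_subset A B : A `<=` B -> lea A B.
Proof.
by move=> AB; apply: HfiniteS (Hfinite0 _) => x [/AB].
Qed.

Lemma leaC A B : nontrivial_ai A -> nontrivial_ai B -> lea A B -> lea (~` B) (~` A).
Proof.
move=> nA nB AB; rewrite /lea setCK setIC.
by apply: small_sym => //; apply: nontrivial_aiC.
Qed.

(** [A] minus [C] is covered by [A] minus [B] and [B] minus [C], both finite over [Stab B]. A
    transfer with [P] the complement of [B] leads back to [Stab A]. *)
Lemma lea_trans A B C : nontrivial_ai A -> nontrivial_ai B ->
  lea A B -> lea B C -> lea A C.
Proof.
move=> nA nB AB BC; have [aiA _ _] := nA; have [_ _ infCB] := nB.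
have AB' : Hfinite (Stab B) (A `&` ~` B).
  by rewrite -StabC; apply: small_sym => //; apply: nontrivial_aiC.
apply: (@Hfinite_transfer A B _ (~` B)) => //.
- apply: HfiniteS (HfiniteU AB' BC) => x [Ax nCx].
  by have [Bx|nBx] := pselect (B x); [right|left].
- by rewrite StabC.
- by rewrite setIC.
Qed.

Lemma lea_absurdr A B : nontrivial_ai A -> lea A B -> lea A (~` B) -> False.
Proof.
move=> [_ infA _] AB ABC; apply: infA; apply: HfiniteS (HfiniteU AB ABC) => x Ax.
by rewrite setCK; have [Bx|nBx] := pselect (B x); [right|left].
Qed.

Lemma lea_absurdl A B : nontrivial_ai A -> nontrivial_ai B ->
  lea A B -> lea (~` A) B -> False.
Proof.
move=> nA nB /leaC-/(_ nA nB) BA /leaC.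
move=> /(_ (nontrivial_aiC nA) nB); apply: lea_absurdr BA.
exact: nontrivial_aiC.
Qed.

Lemma lea_ltrans g A B : lea A B -> lea (ltrans g A) (ltrans g B).
Proof.
move=> /(Hfinite_ltrans g); apply: HfiniteS => x.
by rewrite !ltransE.
Qed.

End AlmostInvariance.

(** * Half-trees *)

Section HalfTrees.
Variables (G : groupType) (T : gtree G).
Implicit Types (a b c d u v w x y : T) (Z W : set T) (F : set (set T)) (g h : G).

Definition half_tree Z := exists a b, adj a b /\ Z = points_away a b.

Lemma connected_ind (P : T -> Prop) u :
  P u -> (forall x y, adj x y -> P x -> P y) -> forall w, P w.
Proof.
move=> Pu Pstep w; have [p + <-] := adj_connected u w.
elim: p u Pu => //= x p IHp u Pu /andP[ux /IHp]; apply; exact: Pstep ux Pu.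
Qed.

(** * Half-trees as the sides of an edge *)

Lemma points_away_src a b : points_away a b a.
Proof. by exists [::]. Qed.

Lemma points_away_step a b x y :
  points_away a b x -> edge_removed a b x y -> points_away a b y.
Proof.
move=> [p ap <-] xy; exists (rcons p y); last by rewrite last_rcons.
by rewrite rcons_path ap.
Qed.

Lemma points_away_ind a b (P : T -> Prop) :
  P a -> (forall x y, points_away a b x -> points_away a b y ->
    adj x y -> P x -> P y) ->
  forall x, points_away a b x -> P x.
Proof.
move=> Pa Pstep x [p + <-]; elim/last_ind: p => //= p y IHp.
rewrite last_rcons rcons_path => /andP[ap lp].
have Zl : points_away a b (last a p) by exists p.
apply: (Pstep (last a p)) => //; last exact: IHp.
  exact: points_away_step lp.
by case/and3P: lp.
Qed.

Lemma points_away_cross a b x y :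
  adj x y -> points_away a b x -> ~ points_away a b y -> x = a /\ y = b.
Proof.
move=> xy Zx nZy; have [[-> ->] //|nab] := (x, y) =P (a, b).
have [[_ ya]|nba] := (x, y) =P (b, a).
  by case: nZy; rewrite ya; apply: points_away_src.
case: nZy; apply: points_away_step Zx _.
by apply/and3P; split=> //; apply/eqP.
Qed.

Lemma points_away_tgt a b : adj a b -> ~ points_away a b b.
Proof.
move=> ab [p ap]; case/shortenP: ap => q aq uq _ lq.
apply: (@adj_acyclic _ _ (a :: q)); last first.
  rewrite /ucycle /cycle uq rcons_path lq adj_sym ab !andbT.
  by apply: sub_path aq => x y /and3P[].
(* The paths too short to close up to a cycle have no edge, so that [a = b], or one edge, which is
   the removed one. *)
case: q aq uq lq => [_ _ /= ab'|x [|//] /= /andP[/and3P[_ /eqP nab _] _] _ xb].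
  by rewrite -ab' adj_irr in ab.
by rewrite xb in nab.
Qed.

Lemma points_awayC a b : adj a b -> points_away b a = ~` points_away a b.
Proof.
move=> ab; apply/seteqP; split.
  apply: points_away_ind => [|x y Zx Zy xy nx ny]; first exact: points_away_tgt.
  have [xb ya] : y = a /\ x = b by apply: points_away_cross; rewrite // adj_sym.
  by subst; apply: (@points_away_tgt b a) => //; rewrite adj_sym.
move=> x nx; suff: points_away a b x \/ points_away b a x by case.
move: x {nx}; apply: (@connected_ind _ a) => [|x y xy].
  by left; apply: points_away_src.
case=> Zx.
  have [Zy|/(points_away_cross xy Zx)[_ ->]] := pselect (points_away a b y).
    by left.
  by right; apply: points_away_src.
have [Zy|/(points_away_cross xy Zx)[_ ->]] := pselect (points_away b a y).
  by right.
by left; apply: points_away_src.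
Qed.

Lemma half_treeC Z : half_tree Z -> half_tree (~` Z).
Proof.
by move=> [a [b [ab ->]]]; exists b, a; rewrite adj_sym (points_awayC ab).
Qed.

Lemma half_tree_nonempty Z : half_tree Z -> exists u, Z u.
Proof. by move=> [a [b [_ ->]]]; exists a; apply: points_away_src. Qed.

Lemma half_tree_cross Z x y :
  half_tree Z -> adj x y -> Z x -> ~ Z y -> Z = points_away x y.
Proof.
by move=> [a [b [_ ->]]] xy Zx nZy; have [-> ->] := points_away_cross xy Zx nZy.
Qed.

(** A path inside [points_away c d] could leave [points_away a b] only across the edge from [a] to
    [b], whose ends do not both lie in [points_away c d]. *)
Lemma points_away_sub a b c d : points_away a b c ->
  ~ (points_away c d a /\ points_away c d b) -> points_away c d `<=` points_away a b.
Proof.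
move=> Zc nab; apply: points_away_ind => // x y Wx Wy xy Zx.
apply: contrapT => nZy; have [xa yb] := points_away_cross xy Zx nZy.
by subst; apply: nab.
Qed.

(** One of the four corners is empty. Which one depends on whether [c] lies in [Z] and whether both
    [a] and [b] lie in [W]. *)
Lemma half_tree_nested Z W : half_tree Z -> half_tree W ->
  [\/ Z `<=` W, Z `<=` ~` W, ~` Z `<=` W | W `<=` Z].
Proof.
move=> [a [b [ab ->]]] [c [d [cd ->]]].
have [Zc|nZc] := pselect (points_away a b c).
  have [[Wa Wb]|nW] := pselect (points_away c d a /\ points_away c d b).
    apply: Or43; rewrite -points_awayC //; apply: points_away_sub => // -[].
    by rewrite (points_awayC ab).
  by apply: Or44; exact: points_away_sub Zc nW.
have [[Wa Wb]|nW] := pselect (points_away c d a /\ points_away c d b).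
  by apply: Or41; apply: points_away_sub => // -[].
apply: Or42 => x Zx Wx; have ba : adj b a by rewrite adj_sym.
have : points_away b a x.
  apply: points_away_sub Wx => [|[? ?]]; first by rewrite points_awayC.
  exact: nW.
by rewrite points_awayC.
Qed.

(** The first step of a simple path from [u] to [a] gives [x]; the rest never returns to [u], so it
    avoids the edge between [x] and [u]. *)
Lemma exists_adj_toward u a : u <> a -> exists2 x, adj u x & points_away x u a.
Proof.
move=> ua; have [p up lp] := adj_connected u a.
move: lp; case/shortenP: up => q uq Uq _.
case: q uq Uq => [//|x q] /= /andP[ux xq] /andP[uq _] lq.
exists x => //; exists q => //.
have avoid z p' : path (@adj _ T) z p' -> all [pred y | y != u] (z :: p') ->
    path (edge_removed x u) z p'.
  elim: p' z => //= y p' IHp z /andP[zy yp] /and3P[zu yu up'].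
  apply/andP; split; last by apply: IHp; rewrite ?yu.
  by apply/and3P; rewrite !xpair_eqE !negb_and zu yu orbT.
apply: avoid xq _; apply/allP => y yq /=.
by apply: contraNneq uq => <-.
Qed.

(** * Families of half-trees that cut out an end *)

Section Ends.
Variable F : set (set T).
Hypothesis F_half_tree : F `<=` half_tree.
Hypothesis F_up : forall B B', F B -> half_tree B' -> B `<=` B' -> F B'.
Hypothesis F_meet : forall B B', F B -> F B' -> ~ (B `<=` ~` B').
Hypothesis F_no_vertex : forall u, exists2 B, F B & ~ B u.

(** Some member of [F] misses [u]; the half-tree beyond the first edge from [u] towards it contains
    it. *)
Lemma end_next u : exists2 x, adj u x & F (points_away x u).
Proof.
have [B FB nBu] := F_no_vertex u; have [a [b [ab EB]]] := F_half_tree FB.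
have ua : u <> a by move=> ua; apply: nBu; rewrite EB ua; apply: points_away_src.
have [x ux xa] := exists_adj_toward ua; exists x => //.
apply: F_up FB _ _; first by exists x, u; rewrite adj_sym.
by rewrite EB; apply: points_away_sub => // -[]; rewrite -EB.
Qed.

(* [F] cuts out an end, and the half-trees of [F] form a neighbourhood basis. *)
Lemma end_directed B u : F B -> exists B', [/\ F B', B' `<=` B & ~ B' u].
Proof.
move=> FB; have [Bu|nBu] := pselect (B u); last by exists B; split=> // ?.
have [a [b [ab EB]]] := F_half_tree FB; move: Bu; rewrite {1}EB.
(* Induction along a path in [B] starting at [a]: each time the member found so far still contains
   the next vertex, it is replaced by one a further edge towards the end. *)
move: u; apply: points_away_ind => [|x y Zx Zy xy].
  have [x ax Fxa] := end_next a; exists (points_away x a); split=> //.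
    have Bx : B x.
      apply: contrapT => nBx; apply: (F_meet FB Fxa).
      have := half_tree_cross (F_half_tree FB) ax _ nBx.
      rewrite {1}EB => /(_ (points_away_src _ _)) ->.
      by rewrite (points_awayC ax) setCK.
    rewrite EB; apply: points_away_sub; first by rewrite -EB.
    by case=> /points_away_tgt; rewrite adj_sym.
  by apply: points_away_tgt; rewrite adj_sym.
move=> [B' [FB' BB' nB'x]].
have [B'y|nB'y] := pselect (B' y); last by exists B'.
have yx : adj y x by rewrite adj_sym.
have EB' := half_tree_cross (F_half_tree FB') yx B'y nB'x.
have [z yz Fzy] := end_next y; exists (points_away z y); split=> //; last first.
  by apply: points_away_tgt; rewrite adj_sym.
apply: subset_trans BB'; rewrite EB'; apply: points_away_sub; last first.
  by case=> /points_away_tgt; rewrite adj_sym.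
(* The end does not turn back: otherwise [F] would contain two complementary half-trees. *)
have zx : z <> x.
  move=> zx; apply: (F_meet FB' Fzy).
  by rewrite EB' zx (points_awayC yx) setCK.
apply: points_away_step (points_away_src _ _) _.
apply/and3P; split=> //; apply/eqP => -[] // _ zy.
by move: yz; rewrite zy adj_irr.
Qed.

End Ends.

(** * The action on half-trees, and pullbacks *)

Definition half_act g Z : set T := [set x | Z (act g^-1 x)].

Lemma actK g : cancel (@act _ T g) (act g^-1).
Proof. by move=> x; rewrite -actM mulVg act1. Qed.

Lemma actVK g : cancel (@act _ T g^-1) (act g).
Proof. by move=> x; rewrite -actM mulgV act1. Qed.

Lemma half_act1 Z : half_act 1 Z = Z.
Proof. by apply/seteqP; split=> x; rewrite /half_act /= invg1 act1. Qed.

Lemma half_actM g h Z : half_act (g * h) Z = half_act g (half_act h Z).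
Proof. by apply/seteqP; split=> x; rewrite /half_act /= invgM actM. Qed.

Lemma half_act_points_away g a b : adj a b ->
  half_act g (points_away a b) = points_away (act g a) (act g b).
Proof.
have sub h c d : adj c d -> forall x, points_away c d x ->
    points_away (act h c) (act h d) (act h x).
  move=> cd; apply: points_away_ind => [|x y Zx Zy xy Zgx].
    exact: points_away_src.
  apply: contrapT => nZ; have := points_away_cross (act_adj h xy) Zgx nZ.
  by case=> _ /(can_inj (actK h)) yd; move: Zy; rewrite yd; apply: points_away_tgt.
move=> ab; apply/seteqP; split=> x.
  by move=> /(sub g _ _ ab); rewrite actVK.
by move=> /(sub g^-1 _ _ (act_adj g ab)); rewrite !actK.
Qed.

Lemma half_tree_act g Z : half_tree Z -> half_tree (half_act g Z).
Proof.
move=> [a [b [ab ->]]]; exists (act g a), (act g b).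
by rewrite half_act_points_away //; split=> //; apply: act_adj.
Qed.

Definition pull v Z : set G := [set g | Z (act g v)].

Lemma pull_act v g Z : pull v (half_act g Z) = ltrans g (pull v Z).
Proof. by rewrite ltransE; apply/seteqP; split=> x; rewrite /pull /= /half_act /= actM. Qed.

(** For adjacent [x] and [y], every [g] with [g x] in [Z] and [g y] outside carries this edge to the
    one bounding [Z], so all such [g] lie in one coset of the stabiliser. The general case adds up
    along a path. *)
Lemma Hfinite_pull_base u w Z : half_tree Z ->
  Hfinite [set g | half_act g Z = Z] (pull u Z `&` ~` pull w Z).
Proof.
move=> hZ; move: w; apply: (@connected_ind _ u) => [|x y xy IH].
  by rewrite setICr; apply: Hfinite0.
suff: Hfinite [set g | half_act g Z = Z] (pull x Z `&` ~` pull y Z).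
  move=> /(HfiniteU IH); apply: HfiniteS => g [Zu nZy].
  by have [Zx|nZx] := pselect (pull x Z g); [right|left].
have [[g0 [Z0 nZ0]]|empty] := pselect (exists g0, (pull x Z `&` ~` pull y Z) g0); last first.
  by apply: HfiniteS (Hfinite0 _) => g Zg; apply: empty; exists g.
apply/HfiniteP; exists [set g0]; first exact: finite_set1.
move=> g [Zx nZy]; exists g0 => //=.
have Eg := half_tree_cross hZ (act_adj g xy) Zx nZy.
have E0 := half_tree_cross hZ (act_adj g0 xy) Z0 nZ0.
rewrite half_actM {1}E0 (half_act_points_away _ (act_adj g0 xy)) !actK.
by rewrite half_act_points_away.
Qed.

End HalfTrees.

(** * Splittings *)

Section SplittingHalfTrees.
Variables (G : groupType) (T : gtree G).
Hypothesis splT : splitting T.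
Implicit Types (a b c d u v w x y : T) (Z W : set T) (g h : G).

Let one_orbit a b x y : adj a b -> adj x y ->
  exists g, (act g a = x /\ act g b = y) \/ (act g a = y /\ act g b = x).
Proof. by have [_ [_]] := splT; apply. Qed.

Lemma half_tree_orbit Z W : half_tree Z -> half_tree W ->
  exists g, W = half_act g Z \/ W = half_act g (~` Z).
Proof.
move=> [a [b [ab ->]]] [c [d [cd ->]]].
have ba : adj b a by rewrite adj_sym.
have [g gab] := one_orbit ab cd; exists g; rewrite -points_awayC //.
rewrite (half_act_points_away _ ab) (half_act_points_away _ ba).
by case: gab => -[-> ->]; [left|right].
Qed.

Lemma splitting_half_tree : exists Z, @half_tree _ T Z.
Proof.
by have [_ [[a [b ab]] _]] := splT; exists (points_away a b), a, b.
Qed.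

(** If [a] were a leaf, every edge would have a leaf as an end and the tree would be a star around
    [b], which would then be a global fixed point. *)
Lemma other_neighbor a b : adj a b -> exists2 c, adj a c & c <> b.
Proof.
move=> ab; apply: contrapT => noc.
have leaf c : adj a c -> c = b.
  by move=> ac; apply: contrapT => cb; apply: noc; exists c.
have leaf_act g c : adj (act g a) c -> c = act g b.
  move=> /(act_adj g^-1); rewrite actK => /leaf <-.
  by rewrite actVK.
have leaves x y : adj x y ->
    (forall c, adj x c -> c = y) \/ (forall c, adj y c -> c = x).
  move=> xy; have [g [[<- <-]|[<- <-]]] := one_orbit ab xy; [left|right] => c;
  exact: leaf_act.
have ba : adj b a by rewrite adj_sym.
have star x : x = b \/ adj b x.
  move: x; apply: (@connected_ind _ _ _ b) => [|x y xy]; first by left.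
  case=> [xb|bx]; first by right; rewrite -xb.
  have [lb|lx] := leaves _ _ bx; left; last exact: lx.
  by apply: leaf; rewrite (lb a ba).
have [nofix _] := splT; apply: nofix; exists b => g.
have [//|bgb] := star (act g b); exfalso.
(* If [g] moves [b] to a neighbour, one of these two vertices is a leaf, which forces [g] to swap
   [a] and [b]. *)
have gab := act_adj g ab; apply: (act_noinv (g := g) ab).
have [lb|lgb] := leaves _ _ bgb.
  have agb := lb a ba; split; last by [].
  by apply: leaf; rewrite adj_sym {2}agb.
have gaE : act g a = b by apply: lgb; rewrite adj_sym.
by split=> //; apply/esym/leaf_act; rewrite gaE.
Qed.

Lemma points_away_subset a b x :
  adj a b -> adj a x -> x <> b -> points_away x a `<` points_away a b.
Proof.
move=> ab ax xb; have xa : adj x a by rewrite adj_sym.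
have nxa := points_away_tgt xa.
split; last first.
  by move=> /(_ a (points_away_src a b)).
apply: points_away_sub => [|[]//].
apply: contrapT => nZx.
by have [] := points_away_cross ax (points_away_src a b) nZx.
Qed.

(** The edge is moved to the next one or two edges of a path [b], [a], [c], [d]. If both moves
    reverse the direction along the path, a composite preserves it. *)
Lemma half_tree_hyperbolic Z : half_tree Z -> exists h, half_act h Z `<` Z.
Proof.
move=> [a [b [ab ->]]]; have [c ac cb] := other_neighbor ab.
have ca : adj c a by rewrite adj_sym.
have cZ := points_away_subset ab ac cb.
have [g [[ga gb]|[ga gb]]] := one_orbit ab ca.
  by exists g; rewrite half_act_points_away // ga gb.
have [d cd da] := other_neighbor ca.
have dc : adj d c by rewrite adj_sym.
have [k [[ka kb]|[ka kb]]] := one_orbit ab dc.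
  exists k; rewrite half_act_points_away // ka kb.
  have [dsub dnsub] := points_away_subset ca cd da.
  have [csub _] := cZ; split; first exact: subset_trans dsub csub.
  by move=> /(subset_trans csub).
(* Here [g] sends [a, b] to [a, c] and [k] sends them to [c, d], so the composite sends [a, b] to
   [k^-1 a, a]; and [k^-1 a] differs from [b] because [d] differs from [a]. *)
exists (k^-1 * g); rewrite half_actM !half_act_points_away ?gb ?ga //.
have kc : act k^-1 c = a by rewrite -ka actK.
rewrite kc; apply: points_away_subset => //.
  by rewrite -{1}kc; apply: act_adj.
by move=> kab; apply: da; rewrite -kb -kab actVK.
Qed.

Lemma vertex_orbit a b v : adj a b -> exists g, act g v = a \/ act g v = b.
Proof.
move=> ab; have [x vx] : exists x, adj v x.
  have [->|va] := pselect (v = a); first by exists b.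
  by have [x vx _] := exists_adj_toward va; exists x.
by have [g [[gv _]|[gv _]]] := one_orbit vx ab; exists g; [left|right].
Qed.

(** Both [a] and [h b] lie in the strip, since otherwise one edge would bound both half-trees; the
    orbit of [v] contains [a] or [b]. *)
Lemma half_tree_between Z h v : half_tree Z -> half_act h Z `<` Z ->
  exists g, Z (act g v) /\ ~ half_act h Z (act g v).
Proof.
move=> hZ [sub nsub]; have [a [b [ab EZ]]] := hZ.
have EW : half_act h Z = points_away (act h a) (act h b).
  by rewrite EZ half_act_points_away.
have Za : Z a by rewrite EZ; apply: points_away_src.
have nZb : ~ Z b by rewrite EZ; apply: points_away_tgt.
have hab := act_adj h ab.
have Wha : half_act h Z (act h a) by rewrite EW; apply: points_away_src.
have nWhb : ~ half_act h Z (act h b) by rewrite EW; apply: points_away_tgt.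
have [g [gv|gv]] := vertex_orbit v ab.
  exists g; rewrite gv; split=> // Wa; apply: nsub.
  have hW := half_tree_act h hZ.
  have nWb : ~ half_act h Z b by move=> /sub.
  by rewrite (half_tree_cross hW ab Wa nWb) -EZ => ?.
exists (h * g); rewrite actM gv; split=> //.
apply: contrapT => nZhb; apply: nsub.
by rewrite EW -(half_tree_cross hZ hab (sub _ Wha) nZhb) => ?.
Qed.

Lemma half_act_pow_neq Z h p : half_act h Z `<` Z -> 0 < p -> half_act (h ^+ p) Z <> Z.
Proof.
move=> [sub nsub]; case: p => // p _ E; apply: nsub => x Zx.
have Zh n y : Z y -> Z (act (h ^+ n) y).
  move=> Zy; elim: n => [|n IHn]; first by rewrite expg0 act1.
  by rewrite expgS actM; apply: sub; rewrite /half_act /= actK.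
have /(Zh p) : Z (act (h ^+ p.+1)^-1 x) by rewrite -[in Z x]E in Zx.
by rewrite -actM expgS invgM mulVKg.
Qed.

Lemma half_act_powV_neq Z h p :
  half_act h Z `<` Z -> 0 < p -> half_act (h^-1 ^+ p) Z <> Z.
Proof.
move=> hZ p0 E; apply: (half_act_pow_neq hZ p0).
by rewrite -{1}E -half_actM expVgn mulgV half_act1.
Qed.

End SplittingHalfTrees.

(** * Almost invariant sets pulled back from a splitting *)

Section SplittingSets.
Variables (G : groupType) (T : gtree G).
Hypothesis splT : splitting T.
Implicit Types (u v w : T) (Z W : set T) (g h : G) (A : set G).

Lemma pull_nonempty v Z : half_tree Z -> exists g, pull v Z g.
Proof.
move=> hZ; have [h hhZ] := half_tree_hyperbolic splT hZ.
by have [g [Zg _]] := half_tree_between splT v hZ hhZ; exists g.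
Qed.

Lemma pull_disjointF v Z W :
  half_tree Z -> pull v Z `<=` pull v W -> ~ (Z `<=` ~` W).
Proof.
move=> hZ ZW ZWC; have [g Zg] := pull_nonempty v hZ.
by apply: (ZWC _ Zg); apply: ZW.
Qed.

(** If [g] stabilises the pullback, [Z] and its translate by [g] have the same pullback. They are
    nested; disjointness or covering would make a pullback empty or everything, and a strict
    inclusion would leave a strip met by the orbit of [v]. *)
Lemma Stab_pull v Z :
  half_tree Z -> Stab (pull v Z) = [set g | half_act g Z = Z].
Proof.
move=> hZ; apply/seteqP; split=> g; last by rewrite /Stab /= -pull_act => ->.
have sub h : Stab (pull v Z) h -> half_act h Z `<=` Z -> half_act h Z = Z.
  rewrite /Stab /= -pull_act => E hhZ; apply: contrapT => neq.
  have [|k [Zk]] := @half_tree_between _ _ splT _ h v hZ.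
    by split=> // Zh; apply: neq; apply/seteqP.
  by apply; have : pull v Z k by []; rewrite -{1}E.
move=> Sg; have hgZ := half_tree_act g hZ.
have E : pull v (half_act g Z) = pull v Z by rewrite pull_act.
have [gZ|gZ|gZ|gZ] := half_tree_nested hgZ hZ.
- exact: sub.
- by case: (@pull_disjointF v _ _ hgZ _ gZ); rewrite E.
- case: (@pull_disjointF v (~` half_act g Z) (~` Z)); last by rewrite setCK.
    exact: half_treeC.
  move=> x; rewrite /pull /= => nZ Zx; apply: nZ.
  by have : pull v Z x by []; rewrite -{1}E.
- have E' := sub _ (StabV Sg).
  rewrite /= -{1}E' -?half_actM ?mulgV ?half_act1 //.
  move=> x; rewrite /half_act /= invgK => Zx.
  by have := gZ _ Zx; rewrite /half_act /= actK.
Qed.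

(** Powers of a hyperbolic [h] keep a point inside [Z], and no positive power stabilises [Z]. *)
Lemma pull_infinite v Z : half_tree Z -> ~ Hfinite (Stab (pull v Z)) (pull v Z).
Proof.
move=> hZ fin; have [h hhZ] := half_tree_hyperbolic splT hZ.
have [g [Zg _]] := half_tree_between splT v hZ hhZ.
have [|p p0] := @Hfinite_powers _ _ _ h g fin.
  elim=> [|n IHn]; first by rewrite expg0 mul1g.
  rewrite expgS -mulgA /pull /= actM; apply: (proj1 hhZ).
  by rewrite /half_act /= actK.
by rewrite Stab_pull //; apply: half_act_pow_neq.
Qed.

Lemma lea_pull_base u v Z : half_tree Z -> lea (pull u Z) (pull v Z).
Proof. by move=> hZ; rewrite /lea Stab_pull //; apply: Hfinite_pull_base. Qed.

Lemma pull_nontrivial v Z : half_tree Z -> nontrivial_ai (pull v Z).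
Proof.
move=> hZ; split; last 1 first.
- by rewrite -StabC; apply: (@pull_infinite v (~` Z)); apply: half_treeC.
- split=> [h|g]; first by [].
  (* Right translation only moves the base vertex. *)
  have -> : rtrans (pull v Z) g = pull (act g^-1 v) Z.
    by rewrite rtransE; apply/seteqP; split=> x; rewrite /pull /= actM.
  rewrite /almost_equal !setDE Stab_pull //.
  by apply: HfiniteU; apply: Hfinite_pull_base.
exact: pull_infinite.
Qed.

(* Were [h] to move [Z], the orbit of a point of the strip between [Z] and
   [half_act h Z] under the powers of [h] would lie on one side of the
   [h]-invariant set [A], hence run off inside the symmetric difference. *)
Lemma Stab_almost_equal_sub v Z A : half_tree Z -> nontrivial_ai A ->
  lea A (pull v Z) -> lea (pull v Z) A -> Stab A `<=` Stab (pull v Z).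
Proof.
move=> hZ nA AZ ZA; have nZ := pull_nontrivial v hZ.
have strip h : Stab A h -> ~ half_act h Z `<` Z.
  move=> Ah hhZ; have [sub _] := hhZ.
  have [g [Zg nhZg]] := half_tree_between splT v hZ hhZ.
  have Apow n x : A (h ^+ n * x) <-> A x.
    have /StabP : Stab A (h ^+ n); last exact.
    elim: n => [|n IHn]; first exact: Stab1.
    by rewrite expgS; apply: StabM.
  have [Ag|nAg] := pselect (A g).
    have fin : Hfinite (Stab (pull v Z)) (A `&` ~` pull v Z).
      by rewrite -StabC; apply: small_sym => //; apply: nontrivial_aiC.
    (* The orbit starts at [h^-1 * g], already outside the pullback because [g v] is not in the
       translate of [Z] by [h]. *)
    have [n|p p0] := @Hfinite_powers _ _ _ h^-1 (h^-1 * g) fin.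
      rewrite mulgA -expgSr; split.
        by apply/(Apow n.+1); rewrite expVgn mulVKg.
      rewrite /pull /= actM; elim: n => [|n IHn]; first by rewrite expg1.
      rewrite expgS actM => Zn; apply: IHn; apply: sub.
      exact: Zn.
    by rewrite Stab_pull //; apply: half_act_powV_neq.
  have [n|p p0] := @Hfinite_powers _ _ _ h g ZA.
    split; last by move/Apow.
    elim: n => [|n IHn]; first by rewrite expg0 mul1g.
    rewrite expgS -mulgA /pull /= actM; apply: sub.
    by rewrite /half_act /= actK.
  by rewrite Stab_pull //; apply: half_act_pow_neq.
move=> h Ah; rewrite Stab_pull //=.
have hhZ := half_tree_act h hZ; have nhZ := pull_nontrivial v hhZ.
have hA : lea A (pull v (half_act h Z)).
  by rewrite pull_act -[X in lea X _]Ah; apply: lea_ltrans.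
have Ah' : lea (pull v (half_act h Z)) A.
  by rewrite pull_act -[X in lea _ X]Ah; apply: lea_ltrans.
have [s|s|s|s] := half_tree_nested hhZ hZ.
(* [Z] and its translate are almost equal through [A], so they are neither disjoint nor covering;
   [strip] for [h] and [h^-1] excludes strict inclusions. *)
- apply: contrapT => neq; apply: (strip h Ah); split=> // s'.
  by apply: neq; apply/seteqP.
- exfalso; apply: (lea_absurdr nhZ (lea_trans nhZ nA Ah' AZ)).
  by apply: lea_subset => x; apply: s.
- exfalso; apply: (lea_absurdl nhZ nZ (lea_trans nhZ nA Ah' AZ)).
  by apply: lea_subset => x; apply: s.
- apply: contrapT => neq; apply: (strip h^-1 (StabV Ah)); split.
    by move=> x; rewrite /half_act /= invgK => /s; rewrite /half_act /= actK.
  move=> s'; apply: neq; apply/seteqP; split=> // x Zx.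
  by have := s' _ Zx; rewrite /half_act /= invgK actVK.
Qed.

Lemma Sigma_pull v Z A : half_tree Z ->
  Sigma (pull v Z) A <-> exists2 W, half_tree W & A = pull v W.
Proof.
move=> hZ; split=> [[g [->|->]]|[W hW ->]].
- by exists (half_act g Z); [apply: half_tree_act|rewrite pull_act].
- exists (half_act g (~` Z)); last by rewrite pull_act.
  by apply: half_tree_act; apply: half_treeC.
- have [g [->|->]] := half_tree_orbit splT hZ hW; exists g; rewrite pull_act;
  by [left|right].
Qed.

End SplittingSets.

(** * Pairs of splittings *)

(** For splittings one such pair is enough: by the single edge orbit every half-tree then has a
    partner. *)
Definition almost_equal_half_trees (G : groupType) (T1 T2 : gtree G) (v1 : T1)
    (v2 : T2) :=
  exists Z W, [/\ half_tree Z, half_tree W, lea (pull v1 Z) (pull v2 W)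
    & lea (pull v2 W) (pull v1 Z)].

Lemma almost_equal_half_trees_sym (G : groupType) (T1 T2 : gtree G) (v1 : T1)
    (v2 : T2) :
  almost_equal_half_trees v1 v2 -> almost_equal_half_trees v2 v1.
Proof. by move=> [Z [W [hZ hW ZW WZ]]]; exists W, Z. Qed.

(** By transitivity and nesting the only alternative is that [W] lies in [Z], and then [Y] is almost
    equal to [Z]. *)
Lemma sub_lea_lea (G : groupType) (T1 T2 : gtree G) (v1 : T1) (v2 : T2) :
  splitting T1 -> splitting T2 -> ~ almost_equal_half_trees v1 v2 ->
  forall Z W Y, half_tree Z -> half_tree W -> half_tree Y ->
  lea (pull v1 Z) (pull v2 Y) -> lea (pull v2 Y) (pull v1 W) -> Z `<=` W.
Proof.
move=> spl1 spl2 ne Z W Y hZ hW hY ZY YW.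
have [nZ nW] := (pull_nontrivial spl1 v1 hZ, pull_nontrivial spl1 v1 hW).
have nY := pull_nontrivial spl2 v2 hY.
have ZW := lea_trans nZ nY ZY YW.
have [//|s|s|s] := half_tree_nested hZ hW; exfalso.
- by apply: (lea_absurdr nZ ZW); apply: lea_subset => x; apply: s.
- by apply: (lea_absurdl nZ nW ZW); apply: lea_subset => x; apply: s.
apply: ne; exists Z, Y; split=> //; apply: (lea_trans nY nW YW).
by apply: lea_subset => x; apply: s.
Qed.

(** * Half-trees forced by a vertex of another tree *)

Section Bounded.
Variables (G : groupType) (T1 T2 : gtree G) (v1 : T1) (v2 : T2).
Hypotheses (spl1 : splitting T1) (spl2 : splitting T2).
Hypothesis ne : ~ almost_equal_half_trees v1 v2.
Hypothesis lower_bound : forall A B, half_tree A -> half_tree B ->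
  lea (pull v1 A) (pull v2 B) ->
  exists2 C, half_tree C & lea (pull v2 C) (pull v1 A).

Definition forced (w : T1) : set (set T2) :=
  [set B | half_tree B /\
    exists A, [/\ half_tree A, A w & lea (pull v1 A) (pull v2 B)]].

Lemma forced_up w B B' : forced w B -> half_tree B' -> B `<=` B' -> forced w B'.
Proof.
move=> [hB [A [hA Aw AB]]] hB' BB'; split=> //; exists A; split=> //.
apply: (lea_trans (pull_nontrivial spl1 v1 hA) (pull_nontrivial spl2 v2 hB) AB).
by apply: lea_subset => x; apply: BB'.
Qed.

Let ne' : ~ almost_equal_half_trees v2 v1.
Proof. by move=> /almost_equal_half_trees_sym. Qed.

(** If [B] and [B'] were disjoint, their witnesses [A] and [A'] would be disjoint by [sub_lea_lea],
    yet both contain [w]. *)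
Lemma forced_meet w B B' : forced w B -> forced w B' -> ~ (B `<=` ~` B').
Proof.
move=> FB [hB' [A' [hA' A'w AB']]] BB'.
have [hB'C [A [hA Aw AB]]] := forced_up FB (half_treeC hB') BB'.
have := leaC (pull_nontrivial spl1 v1 hA') (pull_nontrivial spl2 v2 hB') AB'.
by move=> /(sub_lea_lea spl1 spl2 ne hA (half_treeC hA') hB'C AB)/(_ _ Aw).
Qed.

(* If [forced w] cut out an end of [T2] it would be the same end for all [w].
   For [B] in [forced w] the half-trees below [B] then cover [T1], from which
   they are the same for all [B] in [forced w].  A lower bound for one of them
   is a lower bound for [forced w]. *)
Lemma forced_bounded w : exists u, forall B, forced w B -> B u.
Proof.
apply: contrapT => nou.
have no_vertex x : forced w `<=` forced x ->
    forall u, exists2 B, forced x B & ~ B u.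
  move=> wx u; apply: contrapT => noB; apply: nou; exists u => B /wx FB.
  by apply: contrapT => nBu; apply: noB; exists B.
have F_half x : forced x `<=` @half_tree G T2 by move=> B [].
have directed x : forced w `<=` forced x -> forall B u, forced x B ->
    exists B', [/\ forced x B', B' `<=` B & ~ B' u].
  move=> wx B u; apply: end_directed => //; first exact: forced_up.
    exact: forced_meet.
  exact: no_vertex.
(* A member avoiding some vertex of [C] cannot lie above [A], as it would then contain [C]. *)
have not_lower A C x : forced w `<=` forced x -> half_tree A -> half_tree C ->
    lea (pull v2 C) (pull v1 A) ->
    forall B, forced x B -> exists B',
    [/\ forced x B', B' `<=` B & ~ lea (pull v1 A) (pull v2 B')].
  move=> wx hA hC CA B FB; have [u Cu] := half_tree_nonempty hC.
  have [B' [FB' BB' nB'u]] := directed x wx B u FB; exists B'; split=> // AB'.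
  by apply: nB'u; apply: (sub_lea_lea spl2 spl1 ne' hC (F_half _ _ FB') hA CA AB').
(* If the witness [A] for [B] is lost in crossing from [x] to [y], it is bounded by that edge. The
   witness for a smaller [B'] not above [A] is a different half-tree, hence still contains [y]. *)
have wall x : forced w `<=` forced x.
  move: x; apply: (@connected_ind _ _ _ w) => // x y xy wx B /wx FB.
  have [hB [A [hA Ax AB]]] := FB.
  have [Ay|nAy] := pselect (A y); first by split=> //; exists A.
  have EA := half_tree_cross hA xy Ax nAy.
  have [C hC CA] := lower_bound hA hB AB.
  have [B' [FB' BB' nAB']] := not_lower A C x wx hA hC CA B FB.
  have [hB' [A' [hA' A'x AB']]] := FB'.
  apply: forced_up hB BB'; split=> //; exists A'; split=> //.
  apply: contrapT => nA'y; apply: nAB'.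
  by rewrite EA -(half_tree_cross hA' xy A'x nA'y).
have [B FB _] := no_vertex w (fun _ => id) v2.
have [hB [A [hA Aw AB]]] := FB.
have [C hC CA] := lower_bound hA hB AB.
have [B' [FB' BB' nAB']] := not_lower A C w (fun _ => id) hA hC CA B FB.
apply: nAB'; have [a [b [ab EA]]] := hA.
(* The witness [A'] is taken at the far end [b] of the edge of [A]. It either contains [A], against
   the choice of [B'], or covers the complement of [A], putting both [A] and its complement below
   [B]. *)
have [hB' [A' [hA' A'b AB']]] := wall b _ FB'.
have [nA nA'] := (pull_nontrivial spl1 v1 hA, pull_nontrivial spl1 v1 hA').
have [nB nB'] := (pull_nontrivial spl2 v2 hB, pull_nontrivial spl2 v2 hB').
have nAb : ~ A b by rewrite EA; apply: points_away_tgt.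
have A'B : lea (pull v1 A') (pull v2 B).
  by apply: (lea_trans nA' nB' AB'); apply: lea_subset => x; apply: BB'.
have cover : ~ (~` A `<=` A').
  move=> s; apply: (lea_absurdl nA nB AB).
  apply: lea_trans A'B; [exact: nontrivial_aiC|by []|].
  by apply: lea_subset => x; apply: s.
have [s|s|//|/(_ _ A'b)//] := half_tree_nested hA hA'.
  by apply: lea_trans AB' => //; apply: lea_subset => x; apply: s.
exfalso; apply: cover; have ba : adj b a by rewrite adj_sym.
have nA'a : ~ A' a by move=> A'a; apply: (s a) => //; rewrite EA; apply: points_away_src.
by rewrite (half_tree_cross hA' ba A'b nA'a) EA (points_awayC ab) => ?.
Qed.

End Bounded.

Lemma almost_equal_half_treesP (G : groupType) (T1 T2 : gtree G) (v1 : T1) (v2 : T2) :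
  splitting T1 -> splitting T2 -> almost_equal_half_trees v1 v2 ->
  forall W, half_tree W -> exists Z,
  [/\ half_tree Z, lea (pull v1 Z) (pull v2 W) & lea (pull v2 W) (pull v1 Z)].
Proof.
move=> spl1 spl2 [Z0 [W0 [hZ hW ZW WZ]]] W /(half_tree_orbit spl2 hW)[g EW].
have nZ := pull_nontrivial spl1 v1 hZ; have nW := pull_nontrivial spl2 v2 hW.
case: EW => ->; [exists (half_act g Z0)|exists (half_act g (~` Z0))];
  rewrite !pull_act; (split; first by apply: half_tree_act => //; apply: half_treeC);
  apply: lea_ltrans => //; exact: leaC.
Qed.

Lemma almost_equal_half_trees_trans (G : groupType) (T1 T2 T3 : gtree G)
    (v1 : T1) (v2 : T2) (v3 : T3) :
  splitting T1 -> splitting T2 -> splitting T3 ->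
  almost_equal_half_trees v1 v2 -> almost_equal_half_trees v2 v3 ->
  almost_equal_half_trees v1 v3.
Proof.
move=> spl1 spl2 spl3 E12 [W [Y [hW hY WY YW]]].
have [Z [hZ ZW WZ]] := almost_equal_half_treesP spl1 spl2 E12 hW.
have nZ := pull_nontrivial spl1 v1 hZ; have nW := pull_nontrivial spl2 v2 hW.
have nY := pull_nontrivial spl3 v3 hY.
by exists Z, Y; split=> //; [apply: lea_trans WY|apply: lea_trans WZ].
Qed.

Lemma ai_le_lea (G : groupType) (A B : set G) : ai_le A B -> lea A B.
Proof.
case=> [AB|/(_ (true, false))[_ ]]; last exact.
by rewrite /lea (_ : A `&` ~` B = set0) //; apply: Hfinite0.
Qed.

(** [A] is a translate of [Z] or of its complement, so the same translate of the lower bound, or of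
    the complement of the upper bound, lies below it. Crossing is excluded by the small corner of
    [A] and [B]. *)
Lemma sandwiched_lower_bound (G : groupType) (T1 T2 : gtree G) (v1 : T1) (v2 : T2)
    (Z : set T1) (W : set T2) :
  splitting T1 -> splitting T2 -> half_tree Z -> half_tree W ->
  sandwiched (pull v1 Z) (pull v2 W) ->
  forall A B, half_tree A -> half_tree B -> lea (pull v1 A) (pull v2 B) ->
  exists2 C, half_tree C & lea (pull v2 C) (pull v1 A).
Proof.
move=> spl1 spl2 hZ hW sand A B hA hB.
have nZ := pull_nontrivial spl1 v1 hZ.
have [g EA] := half_tree_orbit spl1 hZ hA.
case: sand => [[C' [D' [SC SD /ai_le_lea CZ /ai_le_lea ZD]]] _|cross].
  have [C hC EC] := (Sigma_pull spl2 v2 C' hW).1 SC.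
  have [D hD ED] := (Sigma_pull spl2 v2 D' hW).1 SD; subst.
  case: EA => ->; rewrite pull_act.
    exists (half_act g C); first exact: half_tree_act.
    by rewrite pull_act; apply: lea_ltrans.
  exists (half_act g (~` D)); first by apply/half_tree_act/half_treeC.
  rewrite pull_act; apply: lea_ltrans.
  exact: leaC (pull_nontrivial spl2 v2 hD) ZD.
move=> AB; exfalso.
have hgB := half_tree_act g^-1 hB.
have /cross nc : Sigma (pull v2 W) (pull v2 (half_act g^-1 B)).
  by apply/(Sigma_pull spl2 _ _ hW); exists (half_act g^-1 B).
have {}AB : lea (ltrans g^-1 (pull v1 A)) (pull v2 (half_act g^-1 B)).
  by rewrite pull_act; apply: lea_ltrans.
move: AB; case: EA => ->; rewrite pull_act -ltransM mulVg ltrans1.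
  exact: (nc (true, false)).
by rewrite /lea [Stab _]StabC; apply: (nc (false, false)).
Qed.

(** * Simultaneous choice of base vertices *)

Section CompatibleVertices.
Variables (G : groupType) (n : nat) (T : 'I_n -> gtree G) (v : forall j, T j).
Hypothesis splT : forall j, splitting (T j).
Variable J : set 'I_n.
Hypothesis J_sep : forall i j, J i -> J j -> i <> j ->
  ~ almost_equal_half_trees (v i) (v j).
Hypothesis lower_bound : forall i j A B, half_tree A -> half_tree B ->
  lea (pull (v i) A) (pull (v j) B) ->
  exists2 C, half_tree C & lea (pull (v j) C) (pull (v i) A).

(** The preorder is read at the fixed vertices [v]; for splittings, other base vertices give the
    same preorder by [lea_pull_base]. *)
Definition compatible (P : set 'I_n) (w : forall j, T j) :=
  forall i j, P i -> P j -> i <> j -> forall Z W, half_tree Z -> half_tree W ->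
  lea (pull (v i) Z) (pull (v j) W) -> Z (w i) -> W (w j).

(** Without a common vertex the union of the forced families would cut out an end, although each
    family has a common vertex of its own. *)
Lemma common_vertex (P : set 'I_n) (w : forall j, T j) k :
  P `<=` J -> compatible P w -> J k -> ~ P k ->
  exists u, forall i, P i -> forall B, forced (v i) (v k) (w i) B -> B u.
Proof.
move=> PJ compw Jk nPk; apply: contrapT => nou.
have neq i : P i -> i <> k by move=> Pi ik; apply: nPk; rewrite -ik.
have /choice[u uP] i : exists u, P i ->
    forall B, forced (v i) (v k) (w i) B -> B u.
  have [Pi|nPi] := pselect (P i); last by exists (v k).
  have [u uP] := forced_bounded (splT i) (splT k) (J_sep (PJ _ Pi) Jk (neq i Pi))
    (@lower_bound i k) (w i).
  by exists u.
pose F := [set B | exists2 i, P i & forced (v i) (v k) (w i) B].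
have F_half : F `<=` @half_tree G (T k) by move=> B [i _ []].
have F_up B B' : F B -> half_tree B' -> B `<=` B' -> F B'.
  by move=> [i Pi FB] hB' BB'; exists i => //; apply: forced_up FB hB' BB'.
(* For different [i] and [j], disjoint [B] and [B'] give [A] below the complement of [A'], and
   compatibility then puts [w j] outside [A']. *)
have F_meet B B' : F B -> F B' -> ~ (B `<=` ~` B').
  move=> [i Pi FB] [j Pj FB'] BB'.
  have [ij|ij] := eqVneq i j.
    subst j; apply: forced_meet FB FB' BB' => //.
    by apply: J_sep => //; [exact: PJ|exact: neq].
  have hB' : half_tree B' by case: FB'.
  have [hB'C [A [hA Aw AB]]] := forced_up (splT i) (splT k) FB (half_treeC hB') BB'.
  have [_ [A' [hA' A'w AB']]] := FB'.
  have nA := pull_nontrivial (splT i) (v i) hA.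
  have nA' := pull_nontrivial (splT j) (v j) hA'.
  have nB' := pull_nontrivial (splT k) (v k) hB'.
  apply: (compw i j Pi Pj _ A (~` A')) => //; [exact/eqP|exact: half_treeC|].
  by apply: (lea_trans nA (nontrivial_aiC nB') AB); apply: leaC.
have F_no_vertex x : exists2 B, F B & ~ B x.
  apply: contrapT => noB; apply: nou; exists x => i Pi B FB.
  by apply: contrapT => nBx; apply: noB; exists B => //; exists i.
(* A member avoiding the finitely many vertices [u i] belongs to one of the families and so contains
   its [u i]. *)
have [B [i Pi FB] avoid] : exists2 B, F B & forall i, i \in enum 'I_n -> ~ B (u i).
  elim: (enum 'I_n) => [|i s [B FB avoid]].
    by have [B FB _] := F_no_vertex (v k); exists B.
  have [B' [FB' BB' nB'u]] := end_directed F_half F_up F_meet F_no_vertex (u i) FB.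
  exists B' => // j; rewrite inE => /predU1P[-> //|/avoid nBu] /BB'.
  exact: nBu.
by apply: (avoid i); [rewrite mem_enum|apply: uP FB].
Qed.

Lemma compatible_vertices : exists w, compatible J w.
Proof.
suff [w compw] : exists w, compatible [set i | i \in enum 'I_n /\ J i] w.
  by exists w => i j Ji Jj; apply: compw; rewrite /= mem_enum.
elim: (enum 'I_n) => [|k s [w compw]]; first by exists v => i j [].
have [[ks Jk]|nk] := pselect (k \notin s /\ J k); last first.
  have sub i : i \in k :: s -> J i -> i \in s.
    rewrite inE => /predU1P[->|//] Jk; apply: contrapT => /negP ks.
    exact: nk.
  by exists w => i j [/sub si Ji] [/sub sj Jj]; apply: compw; split; auto.
have [u uP] := @common_vertex _ w k (@subIsetr _ _ _) compw Jk
  (fun H => negP ks (proj1 H)).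
exists (eqtype.dfwith w u) => i j [+ Ji] [+ Jj]; rewrite !inE.
have out i' : i' \in s -> eqtype.dfwith w u i' = w i'.
  by move=> si; rewrite eqtype.dfwith_out //; apply: contraNneq ks => ->.
have forcedP i' Z W : i' \in s -> J i' -> half_tree Z -> half_tree W ->
    lea (pull (v i') Z) (pull (v k) W) -> Z (w i') -> W u.
  by move=> si' Ji' hZ hW ZW Zw; apply: (uP i'); split=> //; exists Z.
move=> /predU1P[->|si] /predU1P[->|sj] ij Z W hZ hW ZW.
- by case: ij.
(* A constraint from [k] to [j] is the contrapositive of the one from [j] to [k] for the
   complements. *)
- rewrite eqtype.dfwith_in (out _ sj) => Zu; apply: contrapT => nWw.
  have nZ := pull_nontrivial (splT k) (v k) hZ.
  have nW := pull_nontrivial (splT j) (v j) hW.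
  apply: (forcedP j (~` W) (~` Z) sj Jj) nWw Zu => //; try exact: half_treeC.
  exact: leaC.
- by rewrite eqtype.dfwith_in (out _ si); apply: forcedP.
- by rewrite (out _ si) (out _ sj); apply: compw.
Qed.

End CompatibleVertices.

(** * Very good position *)

Section Corners.
Variable G : groupType.
Implicit Types A B : set G.

Lemma nontrivial_ai_side b A : nontrivial_ai A -> nontrivial_ai (side b A).
Proof. by case: b => //; apply: nontrivial_aiC. Qed.

Lemma small_lea A B c : small A B c <-> lea (side c.1 A) (~` side c.2 B).
Proof. by rewrite /lea setCK /small /corner; case: c.1; rewrite ?StabC. Qed.

(** Two small corners on a common side of [A] or of [B] would make that side finite over its
    stabiliser. *)
Lemma small_opposite A B c d : nontrivial_ai A -> nontrivial_ai B ->
  small A B c -> small A B d -> c <> d -> d = (~~ c.1, ~~ c.2).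
Proof.
move=> nA nB /small_lea + /small_lea; case: c d => [c1 c2] [d1 d2] /=.
have [nsA nsB] := (nontrivial_ai_side c1 nA, nontrivial_ai_side c2 nB).
have sideN b X : side (~~ b) X = ~` side b X by case: b => //=; rewrite setCK.
have [->|/negPf d1N] := eqVneq d1 (~~ c1);
  have [->|/negPf d2N] := eqVneq d2 (~~ c2) => //.
- have -> : d2 = c2 by case: d2 c2 d2N {nsB} => -[].
  by rewrite sideN => AB CAB; case: (lea_absurdl nsA (nontrivial_aiC nsB) AB CAB).
- have -> : d1 = c1 by case: d1 c1 d1N {nsA} => -[].
  by rewrite sideN => AB CAB; case: (lea_absurdr nsA AB CAB).
have -> : d1 = c1 by case: d1 c1 d1N {nsA} => -[].
by have -> : d2 = c2 by case: d2 c2 d2N {nsB} => -[].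
Qed.

(** An empty corner is small. If there are two small corners, they are opposite and one of them is
    the empty one; a sole small corner must be the empty one. *)
Lemma very_good_position_corners (F : set (set G)) :
  F `<=` @nontrivial_ai G ->
  (forall A B, F A -> F B -> (exists k, corner A B k = set0) \/
    forall c, small A B c -> corner A B c = set0) ->
  very_good_position F.
Proof.
move=> nF corners; have empty_small A B k : corner A B k = set0 -> small A B k.
  by rewrite /small => ->; apply: Hfinite0.
split=> [A B FA FB c d cd Sc Sd|A B FA FB].
  have [[k k0]|all0] := corners A B FA FB; last by left; apply: all0.
  have [kc|/eqP kc] := eqVneq k c; first by left; rewrite -kc.
  right; rewrite (small_opposite (nF _ FA) (nF _ FB) Sc Sd cd).
  have Sk := empty_small _ _ _ k0.
  by rewrite -(small_opposite (nF _ FA) (nF _ FB) Sc Sk) //; apply: nesym.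
split=> [AB|]; first by left; apply/seteqP; split=> // x [/= /AB].
case=> [AB x Ax|only].
  by apply: contrapT => nBx; rewrite -[False]/(set0 x) -AB.
suff AB : corner A B (true, false) = set0.
  by move=> x Ax; apply: contrapT => nBx; rewrite -[False]/(set0 x) -AB.
have [[k k0]|all0] := corners A B FA FB; last by apply/all0/only.
by have /only <- := empty_small _ _ _ k0.
Qed.

End Corners.

(** * Pullbacks along compatible vertices *)

Lemma standard_pull (G : groupType) (T : gtree G) (H X : set G) : standard T H X ->
  exists v Z, [/\ @half_tree G T Z, X = pull v Z & H = Stab X].
Proof.
move=> [v [a [b [ab -> _ ->]]]]; exists v, (points_away a b).
by split=> //; exists a, b.
Qed.

Lemma very_good_position_pull (G : groupType) n (T : 'I_n -> gtree G)
    (v w : forall j, T j) (J : set 'I_n) :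
  (forall j, splitting (T j)) -> compatible v J w ->
  very_good_position
    [set A | exists i (Z : set (T i)), [/\ J i, half_tree Z & A = pull (w i) Z]].
Proof.
move=> splT compw; apply: very_good_position_corners.
  by move=> _ [i [Z [_ hZ ->]]]; apply: pull_nontrivial.
move=> _ _ [i [Z [Ji hZ ->]]] [j [W [Jj hW ->]]].
have [ij|/eqP ij] := eqVneq i j.
  subst j; left; have [s|s|s|s] := half_tree_nested hZ hW;
    [exists (true, false)|exists (true, true)|exists (false, false)|exists (false, true)];
    apply/seteqP; split=> // g [] /=.
  - by move=> /s.
  - by move=> /s.
  - by move=> /s.
  - by move=> + /s.
(* Given [g] in a small corner, translating by [g^-1] puts [w i] in the first half-tree, so
   compatibility puts [w j] outside the second, against the choice of [g]. *)
right=> -[c1 c2] /small_lea /= ZW; apply/seteqP; split=> // g [/= Zg Wg].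
have hside k b (Y : set (T k)) : half_tree Y ->
    exists2 Y', half_tree Y' & forall u, side b (pull u Y) = pull u Y'.
  by case: b; [exists Y|exists (~` Y) => //; apply: half_treeC].
have [Z' hZ' EZ] := hside _ c1 _ hZ; have [W' hW' EW] := hside _ c2 _ hW.
rewrite EZ in Zg ZW; rewrite EW in Wg ZW.
have hWC := half_treeC hW'.
have nt k (Y : set (T k)) (u : T k) : half_tree Y -> nontrivial_ai (pull u Y).
  exact: pull_nontrivial.
have {}ZW : lea (pull (v i) Z') (pull (v j) (~` W')).
  apply: (lea_trans (nt _ _ _ hZ') (nt _ _ (w i) hZ')).
    exact: lea_pull_base.
  apply: (lea_trans (nt _ _ _ hZ') (nt _ _ (w j) hWC) ZW).
  exact: lea_pull_base.
have := compw i j Ji Jj ij _ _ (half_tree_act g^-1 hZ') (half_tree_act g^-1 hWC).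
rewrite !pull_act => /(_ (lea_ltrans _ ZW)).
by rewrite /half_act /= invgK => /(_ Zg); apply.
Qed.

Theorem theorem8p10 (G : groupType) (n : nat) (T : 'I_n -> gtree G)
    (T_splitting : forall j, splitting (T j))
    (T_noniso : forall j k, j <> k -> ~ gtree_iso (T j) (T k))
    (T_sandwiching : sandwiching T)
    (H X : 'I_n -> set G)
    (X_standard : forall j, standard (T j) (H j) (X j)) :
  exists X' : 'I_n -> set G,
    [/\ forall j, almost_invariant (H j) (X' j),
        forall j, almost_equal (H j) (X' j) (X j)
      & very_good_position (\bigcup_j Sigma (X' j))].
Proof.
have [X0 [X0_standard X0_sandwiched]] := T_sandwiching.
(* The reference vertices come from the sets for which sandwiching is given; those of the sets [X j]
   may differ, which almost equality absorbs. *)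
have base j : exists v, exists2 Z, @half_tree G (T j) Z & X0 j = pull v Z.
  by have [H0 /standard_pull[v [Z [hZ E _]]]] := X0_standard j; exists v, Z.
pose v j := projT1 (cid (base j)).
have vP j : exists2 Z, half_tree Z & X0 j = pull (v j) Z := projT2 (cid (base j)).
pose eqv i j := almost_equal_half_trees (v i) (v j).
(* The least index of each class serves as its representative. *)
pose J : set 'I_n := [set i | forall i', eqv i' i -> i <= i'].
have J_sep i j : J i -> J j -> i <> j -> ~ eqv i j.
  move=> Ji Jj ij Eij; apply: ij; apply/val_inj/anti_leq/andP; split.
    by apply: Ji; apply: almost_equal_half_trees_sym.
  exact: Jj.
have J_rep j : exists2 i, J i & eqv i j.
  have Ejj : `[< eqv j j >].
    have [Z hZ] := splitting_half_tree (T_splitting j).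
    by apply/asboolP; exists Z, Z; split=> //; apply: lea_subset.
  case: (@arg_minnP _ j (fun i => `[< eqv i j >]) (fun i => i) Ejj).
  move=> i /asboolP Eij min; exists i => //.
  move=> i' Ei'i; apply: min; apply/asboolP.
  exact: almost_equal_half_trees_trans Ei'i Eij.
have lower_bound i j A B : half_tree A -> half_tree B ->
    lea (pull (v i) A) (pull (v j) B) ->
    exists2 C, half_tree C & lea (pull (v j) C) (pull (v i) A).
  have [[Z hZ EZ] [W hW EW]] := (vP i, vP j).
  apply: (sandwiched_lower_bound (Z := Z) (W := W)) => //.
  by rewrite -EZ -EW.
have [w compw] := compatible_vertices T_splitting J_sep lower_bound.
have nt k (Y : set (T k)) (u : T k) : half_tree Y -> nontrivial_ai (pull u Y).
  exact: pull_nontrivial.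
have /choice[X' X'P] j : exists X', [/\ almost_invariant (H j) X',
    almost_equal (H j) X' (X j)
  & exists i (Z : set (T i)), [/\ J i, half_tree Z & X' = pull (w i) Z]].
  have [u [W [hW EX EH]]] := standard_pull (X_standard j).
  have [i Ji Eij] := J_rep j.
  have [Z [hZ ZW WZ]] := almost_equal_half_treesP (T_splitting i) (T_splitting j) Eij hW.
  have nZ := nt _ _ (w i) hZ; have nW := nt _ _ u hW.
  have {}ZW : lea (pull (w i) Z) (pull u W).
    apply: (lea_trans nZ (nt _ _ (v i) hZ)); first exact: lea_pull_base.
    apply: (lea_trans (nt _ _ (v i) hZ) (nt _ _ (v j) hW) ZW).
    exact: lea_pull_base.
  have {}WZ : lea (pull u W) (pull (w i) Z).
    apply: (lea_trans nW (nt _ _ (v j) hW)); first exact: lea_pull_base.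
    apply: (lea_trans (nt _ _ (v j) hW) (nt _ _ (v i) hZ) WZ).
    exact: lea_pull_base.
  (* Both sets are almost equal, so [H j] is also the stabiliser of the new set. *)
  have ES : Stab (pull (w i) Z) = Stab (pull u W).
    by apply/seteqP; split; apply: Stab_almost_equal_sub.
  exists (pull (w i) Z); rewrite EH EX; split; last by exists i, Z.
    by rewrite -ES; case: nZ.
  rewrite /almost_equal !setDE; apply: HfiniteU; last exact: WZ.
  by rewrite -ES.
exists X'; split=> [j|j|]; [by case: (X'P j)|by case: (X'P j)|].
have [good very] := very_good_position_pull T_splitting compw.
have sub : \bigcup_j Sigma (X' j) `<=`
    [set A | exists i (Z : set (T i)), [/\ J i, half_tree Z & A = pull (w i) Z]].
  move=> A [j _]; have [_ _ [i [Z [Ji hZ ->]]]] := X'P j.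
  by move=> /(Sigma_pull (T_splitting i) _ _ hZ)[W hW ->]; exists i, W.
by split=> A B /sub FA /sub FB; [apply: good|apply: very].
Qed.
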